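(* Let $m=m_n\ge1$ and $d=d_n$ be integers with $2\le d\le n$, and let $G_{nmd}$ be the random graph on $\{1,\dots,n\}$ obtained by sampling mutually independent uniformly random $d$-element subsets $V_1,\dots,V_m$ of $\{1,\dots,n\}$ and declaring distinct nodes $i,j$ adjacent iff some $V_k$ contains both. Then, as $n\to\infty$, \[ \mathbb{P}(G_{nmd} \text{ is connected}) \to \begin{cases} 0 & \text{if } \log n + m\log(1-d/n) \to +\infty,\\ 1 & \text{if } \log n + m\log(1-d/n) \to -\infty.\end{cases} \]
   Context: Convention $\log 0=-\infty$. *)

(* Defs.v *)
From HB Require Import structures.
From mathcomp Require Import all_boot all_order all_algebra.
From mathcomp Require Import all_classical all_reals all_analysis.
Set Implicit Arguments. Unset Strict Implicit. Unset Printing Implicit Defensive.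
Import Order.TTheory GRing.Theory Num.Theory.
Local Open Scope ring_scope.

Definition outcome (n m : nat) := {ffun 'I_m -> {set 'I_n}}.

Definition valid_outcome (n m d : nat) (V : outcome n m) : bool :=
  [forall k, #|V k| == d].

Definition gadj (n m : nat) (V : outcome n m) : rel 'I_n :=
  fun i j => (i != j) && [exists k, (i \in V k) && (j \in V k)].

Definition gconnected (n m : nat) (V : outcome n m) : bool :=
  [forall i, forall j, connect (gadj V) i j].

(* Probability (uniform product measure on m independent uniform d-subsets)
   that G_{nmd} is connected. *)
Definition conn_prob_nmd (R : realType) (n m d : nat) : R :=
  (#|[set V : outcome n m | valid_outcome d V && gconnected V]|)%:R /
  (#|[set V : outcome n m | valid_outcome d V]|)%:R.

Definition conn_prob (R : realType) (m d : nat -> nat) (n : nat) : R :=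
  conn_prob_nmd R n (m n) (d n).

(* log n + m log(1 - d/n) in the extended reals, with log 0 = -oo. *)
Definition crit (R : realType) (m d : nat -> nat) (n : nat) : \bar R :=
  if (d n < n)%N then
    ((ln (n%:R : R)) + (m n)%:R * ln (1 - (d n)%:R / n%:R))%:E
  else -oo%E.

(* Main.v *)
(** Write q = 1 - d/n, so that mu = n q^m = exp (log n + m log q) is the expected
    number of nodes lying in no V_j.

    If mu -> +oo, two given nodes are both uncovered with probability at most
    q^(2m); hence the variance of the number of uncovered nodes is at most mu
    and, by Chebyshev, there is one except with probability at most 1/mu. Such a
    node is isolated.

    If mu -> 0, a disconnected graph has a cut S with 1 <= k = |S| <= n/2 such
    that each V_j lies in S or in its complement. One uniform d-set does so with
    probability p_k <= q^t, where t = k (n - k) / (n - 1): for d = 2 this is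
    Bernoulli's inequality, and going from d to d + 1 multiplies p_k by at most
    1 - k / (n - d) <= (1 - 1 / (n - d))^t. Concavity of log gives
    n^((k - 1) / (n - 1)) <= k, so 'C(n, k) n^(-t) <= k^k / k! <= e^k, and since
    t >= k/2 the union bound is dominated by the geometric series of ratio
    e mu^(1/2). *)

Require Import Defs.
From mathcomp Require Import all_boot all_order all_algebra.
From mathcomp Require Import all_classical all_reals all_analysis.
From mathcomp Require Import ring lra zify.
Import Order.TTheory GRing.Theory Num.Theory.
Import numFieldNormedType.Exports.
Local Open Scope ring_scope.

(** * Bernoulli's inequality and concavity of the logarithm *)

(** Apply [ln z <= z - 1] at z = (1 + s y) / (1 + y), and at z = 1 / (1 + y) with weight s - 1: the
    right-hand sides cancel. This is Bernoulli's inequality with a real exponent. *)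
Lemma ler_ln_mul (R : realType) (s y : R) :
  1 <= s -> 0 < 1 + s * y -> ln (1 + s * y) <= s * ln (1 + y).
Proof.
move=> s1 b0.
have a0 : 0 < 1 + y by nra.
have lnB (z : R) : 0 < z -> ln z <= z - 1.
  move=> z0; have -> : z = 1 + (z - 1) by ring.
  by apply: le_trans (le_ln1Dx _) _; lra.
have ab := lnB _ (divr_gt0 b0 a0).
rewrite ln_div ?posrE // in ab.
have aV : - ln (1 + y) <= (1 + y)^-1 - 1.
  by rewrite -lnV ?posrE //; apply: lnB; rewrite invr_gt0.
have : (s - 1) * - ln (1 + y) <= (s - 1) * ((1 + y)^-1 - 1).
  by apply: ler_wpM2l => //; lra.
have -> : (s - 1) * ((1 + y)^-1 - 1) = - ((1 + s * y) / (1 + y) - 1).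
  by field; apply: lt0r_neq0.
by nra.
Qed.

(** By concavity [ln] lies above its chord from 1 to n. This is [ler_ln_mul] with y = k - 1 and s =
    (n - 1) / (k - 1), hence the separate case k = 1. *)
Lemma ln_nat_chord (R : realType) (k n : nat) :
  (0 < k <= n)%N -> (k%:R - 1) * ln (n%:R : R) <= (n%:R - 1) * ln (k%:R : R).
Proof.
case/andP => k0 kn; have [->|k1] := eqVneq k 1%N.
  by rewrite subrr mul0r ln1 mulr0.
have k2 : (2 : R) <= k%:R by rewrite ler_nat; lia.
have knR : (k%:R : R) <= n%:R by rewrite ler_nat.
have k1R : (0 : R) < k%:R - 1 by lra.
have e : 1 + (n%:R - 1) / (k%:R - 1) * (k%:R - 1) = n%:R :> R.
  by field; apply: lt0r_neq0.
have := @ler_ln_mul R ((n%:R - 1) / (k%:R - 1)) (k%:R - 1).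
rewrite e ler_pdivlMr // => /(_ ltac:(lra) ltac:(lra)).
rewrite (_ : 1 + (k%:R - 1) = k%:R :> R); last by ring.
rewrite mulrAC ler_pdivlMr // => h.
by rewrite mulrC.
Qed.

(** * Probability that one random d-set does not cross a cut *)

Lemma natr_mul_binS (R : pzRingType) (j d : nat) :
  d.+1%:R * ('C(j, d.+1))%:R = (j%:R - d%:R) * ('C(j, d))%:R :> R.
Proof.
have [jd|dj] := ltnP j d; first by rewrite !bin_small ?mulr0 //; lia.
by rewrite -natrM mul_bin_left natrM natrB.
Qed.

Lemma natr_mul2_bin2 (R : pzRingType) (j : nat) :
  2%:R * ('C(j, 2))%:R = (j%:R - 1) * j%:R :> R.
Proof. by rewrite natr_mul_binS bin1. Qed.

(** A uniform pair is separated by a cut of sizes k and n - k with probability 2 k (n - k) / (n (n -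
    1)), which is t * (2 / n) for this t. *)
Definition cut_exponent (R : realType) (n k : nat) : R :=
  k%:R * (n%:R - k%:R) / (n%:R - 1).

(** The p_k of the overview: for d >= 1, lying in S and lying in its complement are disjoint
    events. *)
Definition same_side (R : realType) (n k d : nat) : R :=
  ('C(k, d) + 'C(n - k, d))%:R / ('C(n, d))%:R.

Section SameSide.
Context {R : realType} {n k : nat}.
Hypotheses (k_gt0 : (0 < k)%N) (k_half : (k.*2 <= n)%N).

Let t : R := cut_exponent R n k.

Let kR : (1 : R) <= k%:R. Proof. by rewrite ler1n. Qed.
Let nR : k%:R * 2 <= n%:R :> R.
Proof. by rewrite -natrM ler_nat muln2. Qed.
Let nBk : (n - k)%:R = n%:R - k%:R :> R.
Proof. by rewrite natrB //; lia. Qed.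

Lemma cut_exponent_ge1 : 1 <= t.
Proof.
move: (kR) (nR) => k1 n2k.
(* Expands to n - 1 <= k (n - k). *)
have : 0 <= (k%:R - 1) * (n%:R - k%:R - 1) :> R by apply: mulr_ge0; lra.
by rewrite ler_pdivlMr; lra.
Qed.

Lemma cut_exponent_le : t <= k%:R.
Proof. by move: (kR) (nR) => k1 n2k; rewrite ler_pdivrMr; nra. Qed.

Lemma cut_exponent_ge_half : k%:R / 2 <= t.
Proof. by move: (kR) (nR) => k1 n2k; rewrite ler_pdivlMr; nra. Qed.

Lemma same_side_ge0 d : 0 <= same_side R n k d.
Proof. exact: divr_ge0. Qed.

Lemma same_side2 : (2 < n)%N -> same_side R n k 2 = 1 + t * - (2 / n%:R).
Proof.
move: (kR) (nR) => k1 n2k n2; have n2R : (2 : R) < n%:R by rewrite ltr_nat.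
have Cn : ('C(n, 2))%:R = (n%:R - 1) * n%:R / 2 :> R.
  by rewrite -natr_mul2_bin2; field.
have Ck : ('C(k, 2))%:R = (k%:R - 1) * k%:R / 2 :> R.
  by rewrite -natr_mul2_bin2; field.
have Cnk : ('C(n - k, 2))%:R = (n%:R - k%:R - 1) * (n%:R - k%:R) / 2 :> R.
  by rewrite -nBk -natr_mul2_bin2; field.
rewrite /same_side natrD Cn Ck Cnk /t /cut_exponent; field.
by apply/andP; split; apply: lt0r_neq0; lra.
Qed.

(** Passing to d + 1 multiplies the binomial of each side by its size minus d, over d + 1. As k <= n
    - k, both factors are at most that of the larger side, and (n - k - d) / (n - d) = 1 - k / (n -
    d). *)
Lemma same_sideS d : (d < n)%N ->
  same_side R n k d.+1 <= (1 + k%:R * - (n%:R - d%:R)^-1) * same_side R n k d.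
Proof.
move: (kR) (nR) => k1 n2k dn; have dR : (d%:R : R) < n%:R by rewrite ltr_nat.
have S0 : (d.+1%:R : R) != 0 by rewrite pnatr_eq0.
have Cn0 : (0 : R) < ('C(n, d))%:R by rewrite ltr0n bin_gt0 ltnW.
have CS j : ('C(j, d.+1))%:R = (j%:R - d%:R) * ('C(j, d))%:R / d.+1%:R :> R.
  by rewrite -natr_mul_binS mulrAC divff // mul1r.
rewrite /same_side !natrD !CS nBk.
move: (d.+1%:R : R) S0 => e e0.
set a := ('C(k, d))%:R; set b := ('C(n - k, d))%:R; set c := ('C(n, d))%:R.
have a0 : 0 <= a by rewrite ler0n.
have nd0 : (0 : R) < n%:R - d%:R by lra.
have c0 : c != 0 by apply: lt0r_neq0.
have -> : ((k%:R - d%:R) * a / e + (n%:R - k%:R - d%:R) * b / e) /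
    ((n%:R - d%:R) * c / e) =
    ((k%:R - d%:R) * a + (n%:R - k%:R - d%:R) * b) / ((n%:R - d%:R) * c).
  by field; rewrite e0 c0 lt0r_neq0.
have -> : (1 + k%:R * - (n%:R - d%:R)^-1) * ((a + b) / c) =
    ((n%:R - k%:R - d%:R) * a + (n%:R - k%:R - d%:R) * b) / ((n%:R - d%:R) * c).
  by field; rewrite c0 lt0r_neq0.
by apply: ler_wpM2r; [rewrite invr_ge0 mulr_ge0 ?ltW | nra].
Qed.

Lemma same_side_le d : (2 <= d < n)%N ->
  same_side R n k d <= expR (t * ln (1 - d%:R / n%:R)).
Proof.
case/andP; elim: d => // d IH; rewrite ltnS leq_eqVlt => /predU1P [<- n2|d2 dn].
  rewrite same_side2 //; have [le0|gt0] := leP (1 + t * - (2 / n%:R)) 0.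
    exact: le_trans le0 (expR_ge0 _).
  by rewrite -[leLHS]lnK ?posrE // ler_expR ler_ln_mul ?cut_exponent_ge1.
have dR : (d%:R : R) + 2 <= n%:R by rewrite -natrD ler_nat; lia.
have nd0 : (0 : R) < n%:R - d%:R by lra.
have n0 : (n%:R : R) != 0 by rewrite pnatr_eq0; lia.
have d0 : (0 : R) <= d%:R by [].
have inv1 : (n%:R - d%:R)^-1 < 1 :> R by rewrite invf_lt1 //; lra.
have q0 : (0 : R) < 1 - d%:R / n%:R.
  by rewrite subr_gt0 ltr_pdivrMr ?mul1r; lra.
apply: le_trans (same_sideS d _) _; first by lia.
(* For k >= n - d the factor r is not positive and has no useful logarithm, but the bound is then
   trivial. *)
set r := 1 + _; have [le0|gt0] := leP r 0.
  by apply: le_trans (expR_ge0 _); apply: mulr_le0_ge0 => //; exact: same_side_ge0.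
have -> : 1 - d.+1%:R / n%:R = (1 + - (n%:R - d%:R)^-1) * (1 - d%:R / n%:R) :> R.
  by rewrite -natr1; field; rewrite n0 lt0r_neq0.
rewrite lnM ?posrE //; last by lra.
rewrite mulrDr expRD; apply: ler_pM => //; [exact: ltW|exact: same_side_ge0| |].
  (* Bernoulli gives the exponent k; it may be lowered to t <= k because the logarithm of 1 - 1 / (n
     - d) is at most 0. *)
  rewrite -[r]lnK ?posrE // ler_expR.
  apply: le_trans (ler_ln_mul _ _ _ _ _) _ => //.
  apply: ler_wnM2r cut_exponent_le; apply: ln_le0.
  by have := nd0; rewrite -invr_gt0; lra.
by apply: IH => //; lia.
Qed.

End SameSide.

(** * Bounding one term of the union bound *)

(** Each induction step costs (1 + 1/k)^k <= e. *)
Lemma expn_le_fact_expR (R : realType) (k : nat) :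
  k%:R ^+ k <= k`!%:R * expR k%:R :> R.
Proof.
elim: k => [|k IH]; first by rewrite expr0 mul1r expR0.
rewrite exprS factS natrM -mulrA ler_wpM2l //.
apply: (@le_trans _ _ (k%:R ^+ k * expR 1)); last first.
  by rewrite -[in leRHS]natr1 expRD mulrA ler_wpM2r ?expR_ge0.
case: k {IH} => [|k]; first by rewrite !expr0 mul1r -[leLHS]expR0 ler_expR ler01.
have -> : k.+2%:R = k.+1%:R * (1 + k.+1%:R^-1) :> R.
  by rewrite mulrDr mulr1 divff ?natr1 // pnatr_eq0.
rewrite exprMn ler_wpM2l ?exprn_ge0 //.
have -> : (1 : R) = k.+1%:R * k.+1%:R^-1 by rewrite divff // pnatr_eq0.
rewrite expRM_natl divff ?pnatr_eq0 //.
by apply: lerXn2r; rewrite ?nnegrE ?expR_ge0 ?addr_ge0 ?invr_ge0 // expR_ge1Dx.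
Qed.

Lemma ffact_leq_expn (n k : nat) : (n ^_ k <= n ^ k)%N.
Proof.
elim: k => // k IH; rewrite ffactnSr expnSr.
by apply: leq_mul => //; exact: leq_subr.
Qed.

(** The bound is (e n / k)^k, kept as an exponential so that exponents can be added. *)
Lemma bin_le_expR (R : realType) (n k : nat) : (0 < k <= n)%N ->
  ('C(n, k))%:R <= expR (k%:R * (ln n%:R - ln k%:R + 1)) :> R.
Proof.
case/andP => k0 kn; have n0 : (0 < n)%N by lia.
have kR : (0 : R) < k%:R by rewrite ltr0n.
have kk0 : (0 : R) < k%:R ^+ k by rewrite exprn_gt0.
rewrite expRM_natl expRD expRB !lnK ?posrE ?ltr0n // exprMn expr_div_n.
rewrite mulrAC ler_pdivlMr //.
apply: (@le_trans _ _ (('C(n, k))%:R * (k`!%:R * expR k%:R))).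
  by apply: ler_wpM2l => //; exact: expn_le_fact_expR.
rewrite mulrA -natrM bin_ffact -expRM_natl mulr1 ler_wpM2r ?expR_ge0 //.
by rewrite -natrX ler_nat ffact_leq_expn.
Qed.

(** The exponents add up to k + ((k - t) ln n - k ln k) + t c. The bracket is at most 0, and t c <=
    k c / 2 since c <= 0. *)
Lemma bin_same_side_le (R : realType) (n m d k : nat) (c : R) :
  (0 < k)%N -> (k.*2 <= n)%N -> (2 <= d < n)%N ->
  c = ln n%:R + m%:R * ln (1 - d%:R / n%:R) -> c <= 0 ->
  ('C(n, k))%:R * same_side R n k d ^+ m <= expR (1 + c / 2) ^+ k :> R.
Proof.
move=> k0 k2 dn cE c0.
have kn : (0 < k <= n)%N by lia.
have n1 : (0 : R) < n%:R - 1 by rewrite subr_gt0 ltr1n; lia.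
have n1' : (n%:R - 1 : R) != 0 by apply: lt0r_neq0.
pose t := cut_exponent R n k.
have th : k%:R / 2 <= t by exact: cut_exponent_ge_half.
have pm : same_side R n k d ^+ m <= expR (t * (c - ln n%:R)).
  have -> : t * (c - ln n%:R) = m%:R * (t * ln (1 - d%:R / n%:R)).
    by rewrite cE; ring.
  rewrite expRM_natl; apply: lerXn2r; rewrite ?nnegrE ?expR_ge0 //.
    exact: same_side_ge0.
  exact: same_side_le.
apply: le_trans (ler_pM _ _ (bin_le_expR _ _ _ kn) pm) _ => //.
  by rewrite exprn_ge0 // same_side_ge0.
rewrite -expRM_natl -expRD ler_expR.
(* Since k - t = k (k - 1) / (n - 1), this is k times the chord inequality. *)
have kt : (k%:R - t) * ln n%:R <= k%:R * ln k%:R.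
  have -> : (k%:R - t) * ln n%:R = k%:R * ((k%:R - 1) * ln n%:R / (n%:R - 1)).
    by rewrite /t /cut_exponent; field.
  by rewrite ler_wpM2l // ler_pdivrMr // [leRHS]mulrC ln_nat_chord.
have := ler_wnM2r c0 th.
by move: kt; set u := ln n%:R; set v := ln k%:R; nra.
Qed.

(** * Counting outcomes *)

Lemma card_outcome_in (n m : nat) (A : {set {set 'I_n}}) :
  #|[set V : outcome n m | [forall k, V k \in A]]| = (#|A| ^ m)%N.
Proof.
rewrite -[in RHS](card_ord m) -card_ffun_on; apply: eq_card => V.
by rewrite inE; apply/forallP/ffun_onP.
Qed.

(** Taking S to be everything, all but one node, or all but two nodes yields the total count and the
    first and second moments. *)
Lemma card_valid_sub (n m d : nat) (S : {set 'I_n}) :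
  #|[set V : outcome n m | valid_outcome d V && [forall k, V k \subset S]]| =
  ('C(#|S|, d) ^ m)%N.
Proof.
rewrite -cards_draws -card_outcome_in; apply: eq_card => V; rewrite !inE.
apply/andP/forallP => [[/forallP V1 /forallP V2] k|VP].
  by rewrite inE V1 V2.
by split; apply/forallP => k; have := VP k; rewrite inE => /andP [].
Qed.

Lemma card_valid (n m d : nat) :
  #|[set V : outcome n m | valid_outcome d V]| = ('C(n, d) ^ m)%N.
Proof.
rewrite -[in RHS](card_ord n) -cardsT -card_valid_sub; apply: eq_card => V.
by rewrite !inE; case: valid_outcome => //=; symmetry; apply/forallP => k.
Qed.

(** * Uncovered nodes and the second moment method *)

(** Stated as inclusions so that [card_valid_sub] applies, also to two nodes at once. *)
Definition uncovered {n m : nat} (V : outcome n m) (i : 'I_n) : bool :=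
  [forall k, V k \subset ~: [set i]].

Lemma uncoveredP (n m : nat) (V : outcome n m) (i : 'I_n) :
  reflect (forall k, i \notin V k) (uncovered V i).
Proof.
by apply: (iffP forallP) => + k => /(_ k);
  rewrite -finset.disjoints_subset disjoint_sym disjoints1.
Qed.

Lemma gconnected_uncovered (n m : nat) (V : outcome n m) (i : 'I_n) :
  (1 < n)%N -> gconnected V -> ~~ uncovered V i.
Proof.
move=> n1 /forallP /(_ i) /forallP conn; apply/negP => /uncoveredP iV.
have [j ji] : exists j : 'I_n, j != i.
  apply/existsP; apply: contraTT n1 => /existsPn jE; rewrite -leqNgt.
  rewrite -(card_ord n) -(cards1 i) -cardsT subset_leq_card //.
  by apply/fintype.subsetP => j _; rewrite inE; have := jE j; rewrite negbK.
have /connectP [[|x p] /=] := conn j; first by move=> _ E; rewrite E eqxx in ji.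
by case/andP => /andP [_ /existsP [k /andP [ik _]]]; rewrite (negPf (iV k)) in ik.
Qed.

Lemma sum_pred_card (R : pzSemiRingType) (T : finType) (A : {set T}) (P : pred T) :
  \sum_(x in A) (P x)%:R = #|[set x in A | P x]|%:R :> R.
Proof.
rewrite -sum1_card natr_sum [RHS](eq_bigl (fun x => (x \in A) && P x)) => [|x].
  by rewrite big_mkcondr /=; apply: eq_bigr => x _; case: (P x).
by rewrite inE.
Qed.

Section SecondMoment.
Context {R : realType} {n m d : nat}.
Hypotheses (n_gt1 : (1 < n)%N) (d_lt : (d < n)%N).

Let q : R := 1 - d%:R / n%:R.
Let N : R := ('C(n, d) ^ m)%:R.
Let M := [set V : outcome n m | valid_outcome d V].

Lemma natr_bin_pred : ('C(n.-1, d))%:R = q * ('C(n, d))%:R :> R.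
Proof.
have n0 : (n%:R : R) != 0 by rewrite pnatr_eq0; lia.
apply: (mulfI n0); rewrite -natrM mul_bin_down natrM natrB; last by lia.
by rewrite /q; field.
Qed.

Lemma compl_density_ge0 : 0 <= q.
Proof.
have n0 : (0 < n)%N by lia.
by rewrite subr_ge0 ler_pdivrMr ?ltr0n // mul1r ler_nat ltnW.
Qed.

(** Removing the second node gives the exact factor 1 - d / (n - 1), which is at most q: missing two
    nodes is negatively correlated. *)
Lemma natr_bin_pred2_le : ('C(n.-2, d))%:R <= q ^+ 2 * ('C(n, d))%:R :> R.
Proof.
have d0 : (0 : R) <= d%:R by [].
have n1 : (1 : R) < n%:R by rewrite ltr1n.
have n1' : (0 : R) < n.-1%:R by rewrite ltr0n; lia.
rewrite expr2 -mulrA -natr_bin_pred -(ler_pM2l n1') -natrM mul_bin_down natrM.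
rewrite mulrA ler_wpM2r // natrB; last by lia.
rewrite (_ : n.-1%:R = n%:R - 1 :> R); last by rewrite -subn1 natrB //; lia.
rewrite /q mulrBr mulr1 lerD2l lerN2 mulrCA ler_piMr //.
by rewrite ler_pdivrMr; lra.
Qed.

Lemma sum_valid_sub (S : {set 'I_n}) :
  \sum_(V in M) [forall k, V k \subset S]%:R = ('C(#|S|, d))%:R ^+ m :> R.
Proof.
rewrite sum_pred_card -natrX -card_valid_sub; congr (_%:R).
by apply: eq_card => V; rewrite !inE.
Qed.

Lemma sum_uncovered i : \sum_(V in M) (uncovered V i)%:R = q ^+ m * N.
Proof.
rewrite sum_valid_sub cardsC1 card_ord natr_bin_pred.
by rewrite exprMn /N natrX.
Qed.

(** On the diagonal an indicator is its own square, giving q^m; the other summand is slack there,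
    kept so that summing over all pairs gives (mu + mu^2) N. *)
Lemma sum_uncovered2 i j :
  \sum_(V in M) (uncovered V i)%:R * (uncovered V j)%:R <=
  ((i == j)%:R * q ^+ m + q ^+ m * q ^+ m) * N.
Proof.
have N0 : 0 <= N by [].
have qm0 : 0 <= q ^+ m by rewrite exprn_ge0 // compl_density_ge0.
have [<-|ij] := eqVneq i j.
  rewrite (eq_bigr (fun V => (uncovered V i)%:R)) => [|V _]; last first.
    by rewrite -natrM mulnb andbb.
  by rewrite sum_uncovered mul1r ler_wpM2r // lerDl mulr_ge0.
rewrite (eq_bigr (fun V : outcome n m => [forall k, V k \subset ~: [set i; j]]%:R)).
  rewrite sum_valid_sub cardsCs finset.setCK cards2 ij card_ord subn2 mul0r add0r.
  rewrite /N natrX -exprD addnn -mul2n exprM -exprMn.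
  apply: lerXn2r; rewrite ?nnegrE ?mulr_ge0 ?exprn_ge0 ?compl_density_ge0 //.
  exact: natr_bin_pred2_le.
move=> V _; rewrite -natrM mulnb; congr (_%:R); congr nat_of_bool.
apply/andP/forallP => [[/forallP iV /forallP jV] k|ijV].
  by rewrite finset.setCU finset.subsetI iV jV.
by split; apply/forallP => k; have := ijV k;
  rewrite finset.setCU finset.subsetI => /andP [].
Qed.

(** Chebyshev's inequality with sums over outcomes, that is, N times expectations. *)
Lemma conn_prob_mul_le1 : conn_prob_nmd R n m d * (n%:R * q ^+ m) <= 1.
Proof.
have N0 : 0 < N by rewrite ltr0n expn_gt0 bin_gt0 ltnW.
set mu := n%:R * q ^+ m.
have qm0 : 0 <= q ^+ m by rewrite exprn_ge0 // compl_density_ge0.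
have [mu0|mu0] := eqVneq mu 0; first by rewrite mu0 mulr0.
have mu_gt0 : 0 < mu by rewrite lt0r mu0 mulr_ge0.
pose X (V : outcome n m) : R := \sum_i (uncovered V i)%:R.
have EX : \sum_(V in M) X V = mu * N.
  rewrite exchange_big /= (eq_bigr (fun=> q ^+ m * N)) => [|i _].
    by rewrite sumr_const card_ord -mulr_natl mulrA.
  exact: sum_uncovered.
have EX2 : \sum_(V in M) X V ^+ 2 <= (mu + mu ^+ 2) * N.
  under eq_bigr do rewrite expr2 /X big_distrlr /=.
  rewrite exchange_big /=; under eq_bigr do rewrite exchange_big /=.
  apply: le_trans (ler_sum _ (fun i _ =>
    ler_sum _ (fun j _ => sum_uncovered2 i j))) _.
  under eq_bigr do rewrite -mulr_suml big_split /= -mulr_suml sumr_const card_ord.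
  rewrite (eq_bigr (fun=> (q ^+ m + (q ^+ m * q ^+ m) *+ n) * N)) => [|i _].
    have alg (x y z : R) : x * ((y + x * (y * y)) * z) = (x * y + (x * y) ^+ 2) * z.
      by ring.
    by rewrite sumr_const card_ord -!(mulr_natl (_ * _)) alg.
  rewrite (bigD1 i) //= eqxx big1 ?addr0 ?mul1r // => j ji.
  by rewrite eq_sym (negPf ji).
have sqE V : (X V - mu) ^+ 2 = X V ^+ 2 - 2 * mu * X V + mu ^+ 2 by ring.
have var : \sum_(V in M) (X V - mu) ^+ 2 <= mu * N.
  have alg (x y z : R) : z <= (x + x ^+ 2) * y ->
      z - 2 * x * (x * y) + x ^+ 2 * y <= x * y by move=> h; lra.
  under eq_bigr do rewrite sqE.
  rewrite big_split /= sumrB -mulr_sumr EX sumr_const card_valid -(mulr_natr (mu ^+ 2)).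
  exact: alg.
(* A connected outcome has X = 0, so it contributes mu^2; the other squares are dropped. *)
have low : #|[set V : outcome n m | valid_outcome d V && gconnected V]|%:R * mu ^+ 2
    <= \sum_(V in M) (X V - mu) ^+ 2.
  rewrite mulr_natl -sumr_const.
  rewrite [leRHS](bigID (fun V : outcome n m => gconnected V)) /=.
  rewrite -[leLHS]addr0; apply: lerD; last by apply: sumr_ge0 => V _; exact: sqr_ge0.
  rewrite (eq_bigl (fun V => (V \in M) && gconnected V)) => [|V]; last first.
    by rewrite !inE.
  apply: ler_sum => V /andP [_ cV].
  rewrite /X big1 => [|i _]; first by rewrite sub0r sqrrN.
  by rewrite (negPf (gconnected_uncovered _ _ _ i n_gt1 cV)).
rewrite /conn_prob_nmd card_valid -/N mulrAC ler_pdivrMr // mul1r.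
by rewrite -(ler_pM2l mu_gt0) mulrCA -expr2 (le_trans low).
Qed.

End SecondMoment.

(** * Cuts and the union bound *)

(** Each [V k] is a clique, so it lies in a component as soon as it meets it. Take the component of
    [i] or its complement, whichever has at most n/2 nodes. *)
Lemma disconnected_cut (n m : nat) (V : outcome n m) : ~~ gconnected V ->
  exists2 S : {set 'I_n}, (0 < #|S|)%N && (#|S|.*2 <= n)%N &
    forall k, (V k \subset S) || (V k \subset ~: S).
Proof.
case/forallPn => i /forallPn [j ij].
pose C := [set x | connect (gadj V) i x].
have iC : i \in C by rewrite inE connect0.
have jC : j \in ~: C by rewrite !inE.
have cutC k : (V k \subset C) || (V k \subset ~: C).
  have [dis|/pred0Pn [x /andP [/= xV xC]]] := boolP [disjoint V k & C].
    by rewrite -finset.disjoints_subset dis orbT.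
  apply/orP; left; apply/fintype.subsetP => y yV; have [<-//|xy] := eqVneq x y.
  rewrite inE in xC; rewrite inE; apply: connect_trans xC (connect1 _).
  by rewrite /gadj xy; apply/existsP; exists k; rewrite xV yV.
have C0 : (0 < #|C|)%N by apply/card_gt0P; exists i.
have C1 : (0 < #|~: C|)%N by apply/card_gt0P; exists j.
have := cardsC C; rewrite card_ord => cC.
have [le|gt] := leqP #|C|.*2 n; first by exists C => //; rewrite C0.
exists (~: C) => [|k]; last by rewrite finset.setCK orbC.
by rewrite C1 /=; move: cC gt; move: #|C| #|~: C| => a b; lia.
Qed.

Lemma card_disconnected_le (n m d : nat) :
  (#|[set V : outcome n m | valid_outcome d V && ~~ gconnected V]| <=
   \sum_(k < n.+1 | (0 < k) && (k.*2 <= n))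
      'C(n, k) * ('C(k, d) + 'C(n - k, d)) ^ m)%N.
Proof.
pose A (S : {set 'I_n}) := [set B : {set 'I_n} | B \subset S & #|B| == d]
  :|: [set B : {set 'I_n} | B \subset ~: S & #|B| == d].
pose small (S : {set 'I_n}) := (0 < #|S|)%N && (#|S|.*2 <= n)%N.
have cA S : (#|A S| <= 'C(#|S|, d) + 'C(n - #|S|, d))%N.
  have -> : (n - #|S|)%N = #|~: S| by have := cardsC S; rewrite card_ord; lia.
  by rewrite -!cards_draws; apply: leq_card_setU.
apply: (@leq_trans (\sum_(S | small S) #|A S| ^ m)%N).
  pose E S := [set V : outcome n m | [forall k, V k \in A S]].
  have -> : (\sum_(S | small S) #|A S| ^ m = \sum_(S | small S) #|E S|)%N.
    by apply: eq_bigr => S _; rewrite card_outcome_in.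
  have sub : [set V : outcome n m | valid_outcome d V && ~~ gconnected V]
      \subset \bigcup_(S | small S) E S.
    apply/fintype.subsetP => V; rewrite inE => /andP [/forallP vV].
    case/disconnected_cut => S smallS cutS; apply/finset.bigcupP; exists S => //.
    by rewrite inE; apply/forallP => k; rewrite !inE vV !andbT cutS.
  apply: leq_trans (subset_leq_card sub) _.
  apply: (big_ind2 (fun (U : {set outcome n m}) (c : nat) => #|U| <= c)%N) => //.
    by rewrite cards0.
  move=> U1 c1 U2 c2 h1 h2.
  by apply: leq_trans (leq_card_setU _ _) _; apply: leq_add.
have cardS (S : {set 'I_n}) : (#|S| < n.+1)%N.
  by rewrite ltnS -[leqRHS](card_ord n) max_card.
(* Group the cuts by size; [inord] places the size in the finite index type. *)
rewrite (partition_big (fun S : {set 'I_n} => inord #|S| : 'I_n.+1)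
   (fun k : 'I_n.+1 => (0 < k)%N && (k.*2 <= n)%N)) /=; last first.
  by move=> S; rewrite inordK.
apply: leq_sum => k kP.
have -> : 'C(n, k) = #|[set S : {set 'I_n} | #|S| == k]|.
  by rewrite card_draws card_ord.
rewrite -sum_nat_const big_mkcond [leqRHS]big_mkcond /=; apply: leq_sum => S _.
rewrite inE -val_eqE /= inordK //; case: eqP => [<-|]; last by rewrite andbF.
case: ifP => // _; have [->|m0] := posnP m; first by rewrite !expn0.
by rewrite leq_exp2r.
Qed.

Section Connectivity.
Context {R : realType} {n m d : nat}.
Hypothesis d_le : (d <= n)%N.

Let N_gt0 : (0 : R) < ('C(n, d) ^ m)%:R.
Proof. by rewrite ltr0n expn_gt0 bin_gt0 d_le. Qed.

Lemma card_connectedD :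
  (#|[set V : outcome n m | valid_outcome d V && gconnected V]| +
   #|[set V : outcome n m | valid_outcome d V && ~~ gconnected V]| =
   'C(n, d) ^ m)%N.
Proof.
rewrite -card_valid -[RHS](cardsID [set V : outcome n m | gconnected V]).
by congr (_ + _)%N; apply: eq_card => V; rewrite !inE // andbC.
Qed.

Lemma conn_prob_ge0 : 0 <= conn_prob_nmd R n m d.
Proof. exact: divr_ge0. Qed.

Lemma conn_prob_le1 : conn_prob_nmd R n m d <= 1.
Proof.
rewrite /conn_prob_nmd card_valid ler_pdivrMr // mul1r ler_nat.
by rewrite -card_connectedD leq_addr.
Qed.

Lemma disconnected_prob_le : 1 - conn_prob_nmd R n m d <=
  \sum_(k < n.+1 | (0 < k)%N && (k.*2 <= n)%N)
     ('C(n, k))%:R * same_side R n k d ^+ m.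
Proof.
have N0 := lt0r_neq0 N_gt0.
rewrite /conn_prob_nmd card_valid -{1}(divff N0) -mulrBl.
rewrite -{1}card_connectedD natrD addrC addKr ler_pdivrMr //.
apply: (@le_trans _ _ (\sum_(k < n.+1 | (0 < k)%N && (k.*2 <= n)%N)
   'C(n, k) * ('C(k, d) + 'C(n - k, d)) ^ m)%N%:R).
  by rewrite ler_nat card_disconnected_le.
rewrite natr_sum mulr_suml; apply: ler_sum => k _.
by rewrite /same_side natrM !natrX expr_div_n -mulrA divfK // -natrX.
Qed.

(** The case log 0 = -oo. Neither side of a cut can hold n nodes, so each term of the union bound
    contains 0^m with m > 0. *)
Lemma conn_prob_full : (0 < m)%N -> d = n -> conn_prob_nmd R n m d = 1.
Proof.
move=> m0 dn; apply/le_anti; rewrite conn_prob_le1 -subr_le0.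
apply: le_trans disconnected_prob_le _; rewrite big1 // => k /andP [k0 k2].
have kd : (k < d)%N by lia.
have nkd : (n - k < d)%N by lia.
by rewrite /same_side (bin_small kd) (bin_small nkd) mul0r expr0n gtn_eqF ?mulr0.
Qed.

Lemma disconnected_prob_le_expR (c : R) : (2 <= d < n)%N ->
  c = ln n%:R + m%:R * ln (1 - d%:R / n%:R) -> c <= 0 ->
  expR (1 + c / 2) <= 2^-1 -> 1 - conn_prob_nmd R n m d <= 2 * expR (1 + c / 2).
Proof.
move=> dn cE c0; set r := expR _ => r2.
have r0 : 0 <= r := expR_ge0 _.
apply: le_trans disconnected_prob_le _.
apply: (@le_trans _ _ (\sum_(k < n.+1 | (0 < k)%N) r ^+ k)).
  rewrite big_mkcondr /=; apply: ler_sum => k k0.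
  case: ifP => [k2|_]; last exact: exprn_ge0.
  exact: bin_same_side_le.
rewrite big_mkcond big_ord_recl /= add0r.
under eq_bigr do rewrite exprS.
rewrite -mulr_sumr mulrC ler_wpM2r //.
(* From (1 - r) x = 1 - r^n <= 1 and r <= 1/2 follows x <= 2. *)
have := subrX1 r n; have := exprn_ge0 n r0.
have : 0 <= \sum_(i < n) r ^+ i by apply: sumr_ge0 => i _; exact: exprn_ge0.
by set x := \sum_(i < n) _; nra.
Qed.

End Connectivity.

(** * The two limits *)

Local Open Scope classical_set_scope.

Theorem mainTheorem4 (R : realType) (m d : nat -> nat)
  (Hmd : forall n : nat, (2 <= n)%N -> (1 <= m n)%N /\ (2 <= d n <= n)%N) :
  (crit R m d @ \oo --> +oo%E -> conn_prob R m d @ \oo --> (0:R)) /\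
  (crit R m d @ \oo --> -oo%E -> conn_prob R m d @ \oo --> (1:R)).
Proof.
split=> crit_lim; apply/cvgrPdist_le => eps eps0.
  near=> n.
  have n2 : (2 <= n)%N by near: n; exists 2%N.
  (* The probability is at most 1 / mu = exp (- crit), so this threshold makes it at most eps. It
     also excludes d = n, where [crit] is -oo. *)
  have : ((- ln eps)%:E <= crit R m d n)%E by near: n; exact: cvgey_ge.
  rewrite sub0r normrN /conn_prob ger0_norm ?conn_prob_ge0 // /crit.
  case: ifP => // dn; rewrite lee_fin => cA.
  have n0 : (0 : R) < n%:R by rewrite ltr0n ltnW.
  have q0 : (0 : R) < 1 - (d n)%:R / n%:R.
    by rewrite subr_gt0 ltr_pdivrMr // mul1r ltr_nat.
  have muE : n%:R * (1 - (d n)%:R / n%:R) ^+ m n =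
      expR (ln n%:R + (m n)%:R * ln (1 - (d n)%:R / n%:R)) :> R.
    by rewrite expRD expRM_natl !lnK.
  have := @conn_prob_mul_le1 R n (m n) (d n) n2 dn; rewrite muE.
  rewrite -ler_pdivlMr ?expR_gt0 // div1r -expRN => /le_trans; apply.
  by rewrite -[leRHS]lnK ?posrE // ler_expR; lra.
(* Halving gives 2 e <= eps; the minimum with 1 gives e <= 1/2, as the geometric series requires. *)
pose e := Num.min eps 1 / 2.
have e0 : 0 < e by rewrite divr_gt0 // lt_min eps0 ltr01.
have e2 : e <= 2^-1 by rewrite -[leRHS]mul1r ler_wpM2r // ge_min lexx orbT.
have eE : 2 * e <= eps by rewrite mulrC divfK // ge_min lexx.
have lne : ln e <= 0 by apply: ln_le0; lra.
near=> n.
have n2 : (2 <= n)%N by near: n; exists 2%N.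
(* Solves 1 + c / 2 <= ln e for c. *)
have : (crit R m d n <= (2 * (ln e - 1))%:E)%E by near: n; exact: cvgeNy_le.
have [m1 /andP [d2 dn]] := Hmd n n2.
rewrite /conn_prob ger0_norm ?subr_ge0 ?conn_prob_le1 // /crit.
case: ifP => [dn'|/negbT]; last first.
  by rewrite -leqNgt => nd _; rewrite conn_prob_full ?subrr ?ltW //; lia.
rewrite lee_fin; set c := _ + _ => cA.
have re : expR (1 + c / 2) <= e by rewrite -[leRHS]lnK ?posrE // ler_expR; lra.
apply: le_trans (disconnected_prob_le_expR dn c _ _ _ _) _ => //.
- by rewrite d2.
- lra.
- lra.
- lra.
Unshelve. all: by end_near.
Qed.
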